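(* Let $p\in\mathsf{Prop}$ and $\alpha\in\mathsf{AtProg}$. (1) The sequent $p,[\alpha][\alpha^*]p\Rightarrow[\alpha^*]p$ is not cut-free provable in $\mathtt{GTPDL}$; moreover, it is not Fischer–Ladner-cut provable in $\mathtt{GTPDL}$. (2) $p,[\alpha][\alpha^*]p\Rightarrow[\alpha^*]p$ is cut-free provable in $\mathtt{CGTPDL}$. (3) $p\Rightarrow[\alpha]\langle\alpha\rangle^{\leftarrow}p$ is provable in $\mathtt{GTPDL}$ and in $\mathtt{CGTPDL}$. (4) $p\Rightarrow[\alpha]\langle\alpha\rangle^{\leftarrow}p$ is cut-free provable neither in $\mathtt{GTPDL}$ nor in $\mathtt{CGTPDL}$.
   Context: $\mathtt{TPDL}$ formulas/programs over sets $\mathsf{Prop}$, $\mathsf{AtProg}$: $\varphi ::= \bot \mid p \mid (\varphi\to\varphi) \mid [\pi]\varphi \mid [\pi]^{\leftarrow}\varphi$, $\pi ::= \alpha \mid \pi;\pi \mid \pi\cup\pi \mid \pi^{*} \mid \varphi?$. Abbreviations: $\neg\varphi:=\varphi\to\bot$, $\langle\pi\rangle^{\leftarrow}\varphi:=\neg[\pi]^{\leftarrow}\neg\varphi$. $[\pi]\Gamma=\{[\pi]\varphi:\varphi\in\Gamma\}$, similarly $[\pi]^{\leftarrow}\Gamma$. A sequent is a pair $\Gamma\Rightarrow\Delta$ of finite sets of formulas (commas denote union). Common rules (premises / conclusion): (Ax) / $\Gamma\Rightarrow\Delta$, $\Gamma\cap\Delta\neq\emptyset$; ($\bot$) / $\Gamma,\bot\Rightarrow\Delta$;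 ($\to$L) $\Gamma\Rightarrow\varphi,\Delta$ and $\Gamma,\psi\Rightarrow\Delta$ / $\Gamma,\varphi\to\psi\Rightarrow\Delta$; ($\to$R) $\Gamma,\varphi\Rightarrow\psi,\Delta$ / $\Gamma\Rightarrow\varphi\to\psi,\Delta$; (Wk) $\Gamma\Rightarrow\Delta$ / $\Gamma'\Rightarrow\Delta'$, $\Gamma\subseteq\Gamma'$, $\Delta\subseteq\Delta'$; (Cut) $\Gamma\Rightarrow\varphi,\Delta$ and $\Gamma,\varphi\Rightarrow\Delta$ / $\Gamma\Rightarrow\Delta$ ($\varphi$ the cut formula); ($[\,]$) $\Gamma\Rightarrow\varphi,[\pi]^{\leftarrow}\Delta$ / $[\pi]\Gamma\Rightarrow[\pi]\varphi,\Delta$; ($[\,]^{\leftarrow}$) $\Gamma\Rightarrow\varphi,[\pi]\Delta$ / $[\pi]^{\leftarrow}\Gamma\Rightarrow[\pi]^{\leftarrow}\varphi,\Delta$; ($[;]$L) $\Gamma,[\pi_0][\pi_1]\varphi\Rightarrow\Delta$ / $\Gamma,[\pi_0;\pi_1]\varphi\Rightarrow\Delta$; ($[;]$R) $\Gamma\Rightarrow[\pi_0][\pi_1]\varphi,\Delta$ / $\Gamma\Rightarrow[\pi_0;\pi_1]\varphi,\Delta$; ($[\cup]$L) $\Gamma,[\pi_0]\varphi,[\pi_1]\varphi\Rightarrow\Delta$ / $\Gamma,[\pi_0\cup\pi_1]\varphi\Rightarrow\Delta$; ($[\cup]$R) $\Gamma\Rightarrow\Delta,[\pi_0]\varphi$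 and $\Gamma\Rightarrow\Delta,[\pi_1]\varphi$ / $\Gamma\Rightarrow[\pi_0\cup\pi_1]\varphi,\Delta$; ($[*]$L) $\Gamma,\varphi,[\pi][\pi^*]\varphi\Rightarrow\Delta$ / $\Gamma,[\pi^*]\varphi\Rightarrow\Delta$; ($[?]$L) $\Gamma\Rightarrow\varphi,\Delta$ and $\Gamma,\psi\Rightarrow\Delta$ / $\Gamma,[\varphi?]\psi\Rightarrow\Delta$; ($[?]$R) $\Gamma,\varphi\Rightarrow\psi,\Delta$ / $\Gamma\Rightarrow[\varphi?]\psi,\Delta$. $\mathtt{GTPDL}$ adds ($[*]$R) $\Gamma,\varphi\Rightarrow[\pi]\varphi$ / $[\pi^*]\Gamma,\varphi\Rightarrow[\pi^*]\varphi$; its proofs are finite trees of rule instances with all leaves Ax/$\bot$. $\mathtt{CGTPDL}$ instead adds (C-s) $\Gamma\Rightarrow\varphi,\Delta$ and $\Gamma\Rightarrow[\pi][\pi^*]\varphi,\Delta$ / $\Gamma\Rightarrow[\pi^*]\varphi,\Delta$; its proofs are finite trees of rule instances whose leaves are Ax/$\bot$ instances or buds, each bud assigned a companion (an inner node with the same sequent), such that in the graph identifying buds with companions every infinite path has a tail followed by a trace with infinitely many progress points; a trace along a path $(\Gamma_i\Rightarrow\Delta_i)$ is a sequence $\tau_i\in\Delta_i$ which at ($\to$R), ($[;]$R), ($[\cup]$R), ($[?]$R), (C-s) either stays the same or passes from the principal formula to its component in the chosen premise ($\psi$ for $\varphi\to\psi$; $[\pi_0][\pi_1]\varphi$; $[\pi_j]\varphi$;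 $\psi$ for $[\varphi?]\psi$; $\varphi$ or $[\pi][\pi^*]\varphi$ for $[\pi^*]\varphi$, the latter a progress point), at ($[\,]$)/($[\,]^{\leftarrow}$) passes from the principal $[\pi]\varphi$/$[\pi]^{\leftarrow}\varphi$ to $\varphi$, and otherwise stays the same. A proof is cut-free if no Cut instance occurs. The Fischer–Ladner closure: $\mathrm{FL}(\bot)=\{\bot\}$, $\mathrm{FL}(p)=\{p\}$, $\mathrm{FL}(\psi_0\to\psi_1)=\{\psi_0\to\psi_1\}\cup\mathrm{FL}(\psi_0)\cup\mathrm{FL}(\psi_1)$, $\mathrm{FL}([\pi]\psi)=\mathrm{FL}_\Box([\pi]\psi)\cup\mathrm{FL}(\psi)$, $\mathrm{FL}([\pi]^{\leftarrow}\psi)=\mathrm{FL}_\Box([\pi]^{\leftarrow}\psi)\cup\mathrm{FL}(\psi)$; $\mathrm{FL}_\Box([\alpha]\psi)=\{[\alpha]\psi\}$, $\mathrm{FL}_\Box([\pi_0;\pi_1]\psi)=\{[\pi_0;\pi_1]\psi\}\cup\mathrm{FL}_\Box([\pi_0][\pi_1]\psi)\cup\mathrm{FL}_\Box([\pi_1]\psi)$, $\mathrm{FL}_\Box([\pi_0\cup\pi_1]\psi)=\{[\pi_0\cup\pi_1]\psi\}\cup\mathrm{FL}_\Box([\pi_0]\psi)\cup\mathrm{FL}_\Box([\pi_1]\psi)$, $\mathrm{FL}_\Box([\pi^*]\psi)=\{[\pi^*]\psi\}\cup\mathrm{FL}_\Box([\pi][\pi^*]\psi)$, $\mathrm{FL}_\Box([\psi_0?]\psi_1)=\{[\psi_0?]\psi_1\}\cup\mathrm{FL}(\psi_0)$,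 backwards versions analogous except $\mathrm{FL}_\Box([\pi_0;\pi_1]^{\leftarrow}\psi)=\{[\pi_0;\pi_1]^{\leftarrow}\psi\}\cup\mathrm{FL}_\Box([\pi_1]^{\leftarrow}[\pi_0]^{\leftarrow}\psi)\cup\mathrm{FL}_\Box([\pi_0]^{\leftarrow}\psi)$; $\mathrm{FL}(\Lambda)=\bigcup_{\varphi\in\Lambda}\mathrm{FL}(\varphi)$. A Cut instance with conclusion $\Gamma\Rightarrow\Delta$ is a Fischer–Ladner-cut if its cut formula lies in $\mathrm{FL}(\Gamma\cup\Delta)$; a sequent is Fischer–Ladner-cut provable if it has a proof in which every Cut instance is a Fischer–Ladner-cut. *)

(* Defs.v *)
From Stdlib Require Import List.
Import ListNotations.
Set Implicit Arguments.

Section Syntax.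
Variables (P A : Type).

Inductive form : Type :=
| Bot : form
| Var : P -> form
| Imp : form -> form -> form
| Box : prog -> form -> form
| BoxB : prog -> form -> form
with prog : Type :=
| Atom : A -> prog
| Seq : prog -> prog -> prog
| Cho : prog -> prog -> prog
| Star : prog -> prog
| Test : form -> prog.

Definition Neg (f : form) : form := Imp f Bot.
Definition DiaB (pi : prog) (f : form) : form := Neg (BoxB pi (Neg f)).

(* Fischer--Ladner closure: inFL chi phi  <->  chi \in FL(phi);
   inFLb chi phi <-> chi \in FL_Box(phi)  (phi a boxed formula). *)
Inductive inFL : form -> form -> Prop :=
| fl_bot : inFL Bot Bot
| fl_var : forall q, inFL (Var q) (Var q)
| fl_imp : forall f g, inFL (Imp f g) (Imp f g)
| fl_imp_l : forall c f g, inFL c f -> inFL c (Imp f g)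
| fl_imp_r : forall c f g, inFL c g -> inFL c (Imp f g)
| fl_box_b : forall c pi f, inFLb c (Box pi f) -> inFL c (Box pi f)
| fl_box_s : forall c pi f, inFL c f -> inFL c (Box pi f)
| fl_boxB_b : forall c pi f, inFLb c (BoxB pi f) -> inFL c (BoxB pi f)
| fl_boxB_s : forall c pi f, inFL c f -> inFL c (BoxB pi f)
with inFLb : form -> form -> Prop :=
| flb_self : forall pi f, inFLb (Box pi f) (Box pi f)
| flb_seq1 : forall c p0 p1 f, inFLb c (Box p0 (Box p1 f)) -> inFLb c (Box (Seq p0 p1) f)
| flb_seq2 : forall c p0 p1 f, inFLb c (Box p1 f) -> inFLb c (Box (Seq p0 p1) f)
| flb_cho1 : forall c p0 p1 f, inFLb c (Box p0 f) -> inFLb c (Box (Cho p0 p1) f)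
| flb_cho2 : forall c p0 p1 f, inFLb c (Box p1 f) -> inFLb c (Box (Cho p0 p1) f)
| flb_star : forall c p f, inFLb c (Box p (Box (Star p) f)) -> inFLb c (Box (Star p) f)
| flb_test : forall c g f, inFL c g -> inFLb c (Box (Test g) f)
| flbB_self : forall pi f, inFLb (BoxB pi f) (BoxB pi f)
| flbB_seq1 : forall c p0 p1 f, inFLb c (BoxB p1 (BoxB p0 f)) -> inFLb c (BoxB (Seq p0 p1) f)
| flbB_seq2 : forall c p0 p1 f, inFLb c (BoxB p0 f) -> inFLb c (BoxB (Seq p0 p1) f)
| flbB_cho1 : forall c p0 p1 f, inFLb c (BoxB p0 f) -> inFLb c (BoxB (Cho p0 p1) f)
| flbB_cho2 : forall c p0 p1 f, inFLb c (BoxB p1 f) -> inFLb c (BoxB (Cho p0 p1) f)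
| flbB_star : forall c p f, inFLb c (BoxB p (BoxB (Star p) f)) -> inFLb c (BoxB (Star p) f)
| flbB_test : forall c g f, inFL c g -> inFLb c (BoxB (Test g) f).

(* Sequents: pairs of finite sets, represented by lists read as sets. *)
Definition sequent : Type := (list form * list form)%type.
Definition seteq (l l' : list form) : Prop := forall x, In x l <-> In x l'.
Definition sqeq (s s' : sequent) : Prop := seteq (fst s) (fst s') /\ seteq (snd s) (snd s').

Inductive rlab : Type :=
| RAx | RBot
| RImpL : form -> form -> rlab
| RImpR : form -> form -> rlab
| RWk
| RCut : form -> rlab
| RBox : prog -> form -> rlab
| RBoxB : prog -> form -> rlab
| RSeqL : prog -> prog -> form -> rlab
| RSeqR : prog -> prog -> form -> rlab
| RChoL : prog -> prog -> form -> rlab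
| RChoR : prog -> prog -> form -> rlab
| RStarL : prog -> form -> rlab
| RTestL : form -> form -> rlab
| RTestR : form -> form -> rlab
| RStarR : prog -> form -> rlab     (* GTPDL only: ([*]R) *)
| RCs : prog -> form -> rlab        (* CGTPDL only: (C-s) *)
| RBud : list nat -> rlab.          (* CGTPDL bud, with address of its companion *)

Inductive inst : rlab -> sequent -> list sequent -> Prop :=
| i_ax : forall G D f, In f G -> In f D -> inst RAx (G, D) []
| i_bot : forall G D, In Bot G -> inst RBot (G, D) []
| i_impL : forall G D f g,
    inst (RImpL f g) (Imp f g :: G, D) [(G, f :: D); (g :: G, D)]
| i_impR : forall G D f g, inst (RImpR f g) (G, Imp f g :: D) [(f :: G, g :: D)]
| i_wk : forall G D G' D', incl G G' -> incl D D' -> inst RWk (G', D') [(G, D)]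
| i_cut : forall G D f, inst (RCut f) (G, D) [(G, f :: D); (f :: G, D)]
| i_box : forall G D pi f,
    inst (RBox pi f) (map (Box pi) G, Box pi f :: D) [(G, f :: map (BoxB pi) D)]
| i_boxB : forall G D pi f,
    inst (RBoxB pi f) (map (BoxB pi) G, BoxB pi f :: D) [(G, f :: map (Box pi) D)]
| i_seqL : forall G D p0 p1 f,
    inst (RSeqL p0 p1 f) (Box (Seq p0 p1) f :: G, D) [(Box p0 (Box p1 f) :: G, D)]
| i_seqR : forall G D p0 p1 f,
    inst (RSeqR p0 p1 f) (G, Box (Seq p0 p1) f :: D) [(G, Box p0 (Box p1 f) :: D)]
| i_choL : forall G D p0 p1 f,
    inst (RChoL p0 p1 f) (Box (Cho p0 p1) f :: G, D) [(Box p0 f :: Box p1 f :: G, D)]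
| i_choR : forall G D p0 p1 f,
    inst (RChoR p0 p1 f) (G, Box (Cho p0 p1) f :: D)
         [(G, Box p0 f :: D); (G, Box p1 f :: D)]
| i_starL : forall G D p f,
    inst (RStarL p f) (Box (Star p) f :: G, D) [(f :: Box p (Box (Star p) f) :: G, D)]
| i_testL : forall G D f g,
    inst (RTestL f g) (Box (Test f) g :: G, D) [(G, f :: D); (g :: G, D)]
| i_testR : forall G D f g,
    inst (RTestR f g) (G, Box (Test f) g :: D) [(f :: G, g :: D)]
| i_starR : forall G p f,
    inst (RStarR p f) (f :: map (Box (Star p)) G, [Box (Star p) f]) [(f :: G, [Box p f])]
| i_cs : forall G D p f,
    inst (RCs p f) (G, Box (Star p) f :: D)
         [(G, f :: D); (G, Box p (Box (Star p) f) :: D)].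

Definition node_ok (r : rlab) (s : sequent) (ps : list sequent) : Prop :=
  exists c ps', inst r c ps' /\ sqeq s c /\ Forall2 sqeq ps ps'.

Inductive tree : Type := Node : sequent -> rlab -> list tree -> tree.

Definition root_seq (t : tree) : sequent := match t with Node s _ _ => s end.

Fixpoint subtree (t : tree) (a : list nat) : option tree :=
  match a with
  | [] => Some t
  | k :: a' => match t with
               | Node _ _ ts => match nth_error ts k with
                                | Some t' => subtree t' a'
                                | None => None
                                end
               end
  end.

Definition bud_target (r : rlab) : option (list nat) :=
  match r with RBud b => Some b | _ => None end.

Definition wf_tree (ok : sequent -> rlab -> Prop) (root : tree) : Prop :=
  forall a s r ts, subtree root a = Some (Node s r ts) ->
    ok s r /\
    match bud_target r with
    | Some b => ts = [] /\ exists s' r' ts', subtree root b = Some (Node s' r' ts')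
                                           /\ ts' <> [] /\ sqeq s s'
    | None => node_ok r s (map root_seq ts)
    end.

Definition cutpol := sequent -> form -> Prop.
Definition anyCut : cutpol := fun _ _ => True.
Definition noCut : cutpol := fun _ _ => False.
Definition flCut : cutpol :=
  fun s f => exists c, In c (fst s ++ snd s) /\ inFL f c.
Definition cut_ok (pol : cutpol) (s : sequent) (r : rlab) : Prop :=
  forall f, r = RCut f -> pol s f.

Definition is_bud (r : rlab) : Prop := exists b, r = RBud b.
Definition is_cs (r : rlab) : Prop := exists p f, r = RCs p f.
Definition is_starR (r : rlab) : Prop := exists p f, r = RStarR p f.

Definition GProv (pol : cutpol) (S : sequent) : Prop :=
  exists t, sqeq (root_seq t) S /\
    wf_tree (fun s r => ~ is_bud r /\ ~ is_cs r /\ cut_ok pol s r) t.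

(* Graph identifying buds with companions: edge from non-bud node a via premise k. *)
Definition succ_addr (a : list nat) (k : nat) (c : tree) : list nat :=
  match c with Node _ r _ => match bud_target r with Some b => b | None => a ++ [k] end end.

Definition edge (t : tree) (a : list nat) (k : nat) (b : list nat) : Prop :=
  exists s r ts c, subtree t a = Some (Node s r ts) /\ bud_target r = None /\
    nth_error ts k = Some c /\ b = succ_addr a k c.

(* Trace components: passing from the principal formula of rule r to its component
   in premise k. *)
Definition comp (r : rlab) (k : nat) (x y : form) : Prop :=
  match r with
  | RImpR f g => x = Imp f g /\ y = g
  | RSeqR p0 p1 f => x = Box (Seq p0 p1) f /\ y = Box p0 (Box p1 f)
  | RChoR p0 p1 f => x = Box (Cho p0 p1) f /\
                     ((k = 0 /\ y = Box p0 f) \/ (k = 1 /\ y = Box p1 f))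
  | RTestR f g => x = Box (Test f) g /\ y = g
  | RCs p f => x = Box (Star p) f /\
               ((k = 0 /\ y = f) \/ (k = 1 /\ y = Box p (Box (Star p) f)))
  | RBox pi f => x = Box pi f /\ y = f
  | RBoxB pi f => x = BoxB pi f /\ y = f
  | _ => False
  end.

Definition progress (r : rlab) (k : nat) (x y : form) : Prop :=
  exists p f, r = RCs p f /\ k = 1 /\ x = Box (Star p) f /\ y = Box p (Box (Star p) f).

Definition seq_at (t : tree) (a : list nat) : option sequent :=
  match subtree t a with Some u => Some (root_seq u) | None => None end.

Definition lab_at (t : tree) (a : list nat) : option rlab :=
  match subtree t a with Some (Node _ r _) => Some r | None => None end.

(* Global trace condition: every infinite path has a tail followed by a trace
   with infinitely many progress points. *)
Definition good_paths (t : tree) : Prop :=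
  forall (f : nat -> list nat) (ks : nat -> nat),
    (forall i, edge t (f i) (ks i) (f (S i))) ->
    exists (N : nat) (tau : nat -> form),
      (forall i, N <= i ->
         exists s r, seq_at t (f i) = Some s /\ lab_at t (f i) = Some r /\
           In (tau i) (snd s) /\
           (tau (S i) = tau i \/ comp r (ks i) (tau i) (tau (S i)))) /\
      (forall m, exists i, m <= i /\ N <= i /\
         exists r, lab_at t (f i) = Some r /\ progress r (ks i) (tau i) (tau (S i))).

Definition CGProv (pol : cutpol) (S : sequent) : Prop :=
  exists t, sqeq (root_seq t) S /\
    wf_tree (fun s r => ~ is_starR r /\ cut_ok pol s r) t /\ good_paths t.

End Syntax.

Arguments Bot {P A}.
Arguments Var {P A}.
Arguments Imp {P A}.
Arguments Box {P A}.
Arguments BoxB {P A}.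
Arguments Atom {P A}.
Arguments Seq {P A}.
Arguments Cho {P A}.
Arguments Star {P A}.
Arguments Test {P A}.
Arguments noCut {P A}.
Arguments flCut {P A}.
Arguments anyCut {P A}.

(* Main.v *)
Require Import Defs.
From Stdlib Require Import List Relations Classical ClassicalEpsilon Lia.
Import ListNotations.
Set Implicit Arguments.
Unset Strict Implicit.

(* Every rule of GTPDL and CGTPDL, ([*]R) and (C-s) included, is sound for Kripke models of
   tense PDL, so a refutable sequent always has a refutable premise.  Above
   p, [a][a*]p => [a*]p the only rules besides (C-s) are weakening, whose premise is the
   sequent itself or a refutable subsequent, and cuts; a cut on a formula of the
   Fischer-Ladner closure {p, [a][a*]p, [a*]p} has the sequent itself as a premise.  So
   without (C-s) each proof of it would have an infinite branch, impossible in a finite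
   tree, while a single (C-s) step closes it.  Above p => [a]<a>^<- p only weakening applies
   when cuts are forbidden, and star-freeness propagates to premises of cut-free rules, so
   the infinite branch contains no (C-s) step, hence no progress point.  A cut on ~p proves
   it: the box rule reduces ~p => [a]<a>^<- p to the excluded middle => <a>^<- p, [a]^<- ~p. *)

Section SetEquality.
Variables (P A : Type).

Lemma seteq_incl (l l' : list (form P A)) : seteq l l' -> incl l l'.
Proof. intros H x; apply H. Qed.

Lemma sqeq_refl (s : sequent P A) : sqeq s s.
Proof. split; intros x; reflexivity. Qed.

Lemma sqeq_sym (s s' : sequent P A) : sqeq s s' -> sqeq s' s.
Proof. intros [HG HD]; split; intros x; symmetry; [apply HG | apply HD]. Qed.

Lemma sqeq_trans (s s' s'' : sequent P A) : sqeq s s' -> sqeq s' s'' -> sqeq s s''.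
Proof.
  intros [HG HD] [HG' HD']; split; intros x;
    [rewrite (HG x); apply HG' | rewrite (HD x); apply HD'].
Qed.

End SetEquality.

(** * Kripke semantics and soundness *)

Section Semantics.
Variables (P A W : Type) (R : A -> W -> W -> Prop) (V : P -> W -> Prop).

Fixpoint sat (w : W) (f : form P A) {struct f} : Prop :=
  match f with
  | Bot => False
  | Var q => V q w
  | Imp f g => sat w f -> sat w g
  | Box pi g => forall v, rel pi w v -> sat v g
  | BoxB pi g => forall v, rel pi v w -> sat v g
  end
with rel (pi : prog P A) (w v : W) {struct pi} : Prop :=
  match pi with
  | Atom a => R a w v
  | Seq p0 p1 => exists u, rel p0 w u /\ rel p1 u v
  | Cho p0 p1 => rel p0 w v \/ rel p1 w v
  | Star p => clos_refl_trans W (rel p) w v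
  | Test f => w = v /\ sat w f
  end.

Definition valid (s : sequent P A) : Prop :=
  forall w, Forall (sat w) (fst s) -> Exists (sat w) (snd s).

Lemma valid_sqeq s s' : sqeq s s' -> valid s -> valid s'.
Proof.
  intros [HG HD] Hs w Hw.
  apply (incl_Exists (seteq_incl HD)), Hs.
  exact (incl_Forall (seteq_incl HG) Hw).
Qed.

Lemma valid_cons_r G D x :
  (forall w, Forall (sat w) G -> ~ Exists (sat w) D -> sat w x) -> valid (G, x :: D).
Proof.
  intros H w HG; apply Exists_cons.
  destruct (classic (Exists (sat w) D)); auto.
Qed.

Lemma valid_cons_elim w G D x :
  valid (G, x :: D) -> Forall (sat w) G -> sat w x \/ Exists (sat w) D.
Proof. intros H HG; exact (proj1 (Exists_cons _ _ _) (H w HG)). Qed.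

Lemma valid_generalized_cut w G D x y :
  valid (G, x :: D) -> valid (y :: G, D) -> Forall (sat w) G ->
  (sat w x -> sat w y) -> Exists (sat w) D.
Proof.
  intros H0 H1 HG Hxy.
  destruct (valid_cons_elim H0 HG) as [Hx|HD]; [|exact HD].
  exact (H1 w (Forall_cons _ (Hxy Hx) HG)).
Qed.

Lemma valid_box G D pi f :
  valid (G, f :: map (BoxB pi) D) -> valid (map (Box pi) G, Box pi f :: D).
Proof.
  intros H; apply valid_cons_r; intros w HG HD v Hwv; cbn in HG.
  assert (HGv : Forall (sat v) G).
  { rewrite Forall_map in HG; refine (Forall_impl _ _ HG); intros g Hg; exact (Hg v Hwv). }
  destruct (valid_cons_elim H HGv) as [Hf|HBD]; [exact Hf|].
  rewrite Exists_map, Exists_exists in HBD; destruct HBD as [d [Hd Hvd]].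
  exfalso; apply HD, Exists_exists; exists d; split; [exact Hd | exact (Hvd w Hwv)].
Qed.

Lemma valid_boxB G D pi f :
  valid (G, f :: map (Box pi) D) -> valid (map (BoxB pi) G, BoxB pi f :: D).
Proof.
  intros H; apply valid_cons_r; intros w HG HD v Hvw; cbn in HG.
  assert (HGv : Forall (sat v) G).
  { rewrite Forall_map in HG; refine (Forall_impl _ _ HG); intros g Hg; exact (Hg v Hvw). }
  destruct (valid_cons_elim H HGv) as [Hf|HBD]; [exact Hf|].
  rewrite Exists_map, Exists_exists in HBD; destruct HBD as [d [Hd Hvd]].
  exfalso; apply HD, Exists_exists; exists d; split; [exact Hd | exact (Hvd w Hvw)].
Qed.

Lemma valid_starR G p f :
  valid (f :: G, [Box p f]) ->
  valid (f :: map (Box (Star p)) G, [Box (Star p) f]).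
Proof.
  intros H w Hw; cbn in Hw |- *.
  rewrite Forall_cons_iff, Forall_map in Hw; destruct Hw as [Hf HG].
  apply Exists_cons; left; intros v Hwv; apply clos_rt_rtn1 in Hwv.
  induction Hwv as [|y z Hyz Hwy IH]; [exact Hf|].
  assert (HGy : Forall (sat y) G).
  { refine (Forall_impl _ _ HG); intros g Hg; apply Hg, clos_rtn1_rt, Hwy. }
  destruct (valid_cons_elim H (Forall_cons _ IH HGy)) as [Hb|[]%Exists_nil].
  exact (Hb z Hyz).
Qed.

Lemma valid_cs G D p f :
  valid (G, f :: D) -> valid (G, Box p (Box (Star p) f) :: D) ->
  valid (G, Box (Star p) f :: D).
Proof.
  intros H0 H1; apply valid_cons_r; intros w HG HD v Hwv.
  apply clos_rt_rt1n in Hwv; destruct Hwv as [|y v Hwy Hyv].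
  - destruct (valid_cons_elim H0 HG) as [Hf|]; [exact Hf | contradiction].
  - destruct (valid_cons_elim H1 HG) as [Hb|]; [|contradiction].
    exact (Hb y Hwy v (clos_rt1n_rt _ _ _ _ Hyv)).
Qed.

Lemma inst_sound r c ps : inst r c ps -> Forall valid ps -> valid c.
Proof.
  intros Hi Hps; destruct Hi; rewrite ?Forall_cons_iff in Hps; cbn.
  - intros w HG; apply Exists_exists; exists f; split; [exact H0|].
    exact (proj1 (Forall_forall _ _) HG f H).
  - intros w HG; destruct (proj1 (Forall_forall _ _) HG Bot H).
  - destruct Hps as [H0 [H1 _]]; intros w Hw; apply Forall_cons_iff in Hw as [Hfg HG].
    exact (valid_generalized_cut H0 H1 HG Hfg).
  - destruct Hps as [H _]; apply valid_cons_r; intros w HG HD Hf.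
    destruct (valid_cons_elim H (Forall_cons _ Hf HG)) as [Hg|]; [exact Hg | contradiction].
  - destruct Hps as [Hv _]; intros w Hw.
    exact (incl_Exists H0 (Hv w (incl_Forall H Hw))).
  - destruct Hps as [H0 [H1 _]]; intros w HG.
    exact (valid_generalized_cut H0 H1 HG (fun Hf => Hf)).
  - apply valid_box, Hps.
  - apply valid_boxB, Hps.
  - destruct Hps as [H _]; intros w Hw; apply Forall_cons_iff in Hw as [Hx HG].
    apply H, Forall_cons; [|exact HG].
    intros u Hwu v Huv; exact (Hx v (ex_intro _ u (conj Hwu Huv))).
  - destruct Hps as [H _]; apply valid_cons_r; intros w HG HD.
    destruct (valid_cons_elim H HG) as [Hx|]; [|contradiction].
    intros v [u [Hwu Huv]]; exact (Hx u Hwu v Huv).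
  - destruct Hps as [H _]; intros w Hw; apply Forall_cons_iff in Hw as [Hx HG].
    apply H, Forall_cons; [|apply Forall_cons; [|exact HG]];
      intros v Hwv; apply Hx; [left | right]; exact Hwv.
  - destruct Hps as [H0 [H1 _]]; apply valid_cons_r; intros w HG HD.
    destruct (valid_cons_elim H0 HG) as [Hx0|]; [|contradiction].
    destruct (valid_cons_elim H1 HG) as [Hx1|]; [|contradiction].
    intros v [Hwv|Hwv]; [apply Hx0 | apply Hx1]; exact Hwv.
  - destruct Hps as [H _]; intros w Hw; apply Forall_cons_iff in Hw as [Hx HG].
    apply H, Forall_cons; [apply Hx, rt_refl|apply Forall_cons; [|exact HG]].
    intros u Hwu v Huv; apply Hx, rt_trans with u; [apply rt_step|]; assumption.
  - destruct Hps as [H0 [H1 _]]; intros w Hw; apply Forall_cons_iff in Hw as [Hx HG].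
    exact (valid_generalized_cut H0 H1 HG (fun Hf => Hx w (conj eq_refl Hf))).
  - destruct Hps as [H _]; apply valid_cons_r; intros w HG HD v [<- Hf].
    destruct (valid_cons_elim H (Forall_cons _ Hf HG)) as [Hg|]; [exact Hg | contradiction].
  - apply valid_starR, Hps.
  - apply valid_cs; apply Hps.
Qed.

End Semantics.

Definition refutable {P A : Type} (s : sequent P A) : Prop :=
  exists (W : Type) (R : A -> W -> W -> Prop) (V : P -> W -> Prop), ~ valid R V s.

Section Refutability.
Variables (P A : Type).
Implicit Types (s c : sequent P A) (G D : list (form P A)).

Lemma refutable_at W (R : A -> W -> W -> Prop) (V : P -> W -> Prop) (w : W) G D :
  Forall (sat R V w) G -> Forall (fun d => ~ sat R V w d) D -> refutable (G, D).
Proof.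
  intros HG HD; exists W, R, V; intros Hv.
  exact (proj1 (Forall_Exists_neg _ _) HD (Hv w HG)).
Qed.

Lemma refutable_sqeq s s' : sqeq s s' -> refutable s -> refutable s'.
Proof.
  intros Hs [W [R [V Hn]]]; exists W, R, V; intros Hv.
  exact (Hn (valid_sqeq (sqeq_sym Hs) Hv)).
Qed.

Lemma inst_refutable r c ps : inst r c ps -> refutable c -> Exists refutable ps.
Proof.
  intros Hi [W [R [V Hc]]]; apply NNPP; intros Hn.
  apply Hc, (inst_sound Hi), Forall_forall; intros q Hq; apply NNPP; intros Hq'.
  apply Hn, Exists_exists; exists q; split; [exact Hq | exists W, R, V; exact Hq'].
Qed.

Lemma refutable_weaken G D G' D' :
  incl G G' -> incl D D' -> refutable (G', D') -> refutable (G, D).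
Proof.
  intros HG HD H.
  destruct (proj1 (Exists_exists _ _) (inst_refutable (i_wk HG HD) H)) as [q [[<-|[]] Hq]].
  exact Hq.
Qed.

Definition equal_or_refutable (S s : sequent P A) : Prop := sqeq s S \/ refutable s.

Lemma equal_or_refutable_sqeq S s s' :
  sqeq s s' -> equal_or_refutable S s -> equal_or_refutable S s'.
Proof.
  intros Hs [H|H]; [left; exact (sqeq_trans (sqeq_sym Hs) H) | right; exact (refutable_sqeq Hs H)].
Qed.

End Refutability.

Section RuleNodes.
Variables (P A : Type).
Implicit Types (s c : sequent P A) (r : rlab P A) (ps : list (sequent P A)).

Lemma node_ok_of_inst r s ps : inst r s ps -> node_ok r s ps.
Proof.
  intros Hi; exists s, ps; split; [exact Hi | split; [apply sqeq_refl|]].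
  clear Hi; induction ps; constructor; auto using sqeq_refl.
Qed.

Lemma node_ok_not_bud r s ps : node_ok r s ps -> bud_target r = None.
Proof. intros [c [ps' [Hi _]]]; destruct Hi; reflexivity. Qed.

Lemma node_ok_Exists (Q : sequent P A -> Prop) r s ps :
  (forall q q', sqeq q q' -> Q q -> Q q') -> node_ok r s ps ->
  (forall c ps', inst r c ps' -> sqeq s c -> Exists Q ps') -> Exists Q ps.
Proof.
  intros HQ [c [ps' [Hi [Hsc Hps]]]] H; specialize (H c ps' Hi Hsc); clear Hi.
  induction Hps as [|q q' ps ps' Hq Hps IH]; inversion H as [? ? Hq'|? ? Hps']; subst.
  - left; exact (HQ _ _ (sqeq_sym Hq) Hq').
  - right; exact (IH Hps').
Qed.

Lemma node_ok_Forall (Q : sequent P A -> Prop) r s ps :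
  (forall q q', sqeq q q' -> Q q -> Q q') -> node_ok r s ps ->
  (forall c ps', inst r c ps' -> sqeq s c -> Forall Q ps') -> Forall Q ps.
Proof.
  intros HQ [c [ps' [Hi [Hsc Hps]]]] H; specialize (H c ps' Hi Hsc); clear Hi.
  induction Hps as [|q q' ps ps' Hq Hps IH]; inversion H as [|? ? Hq' Hps']; subst;
    constructor; [exact (HQ _ _ (sqeq_sym Hq) Hq') | exact (IH Hps')].
Qed.

Lemma node_ok_refutable r s ps : node_ok r s ps -> refutable s -> Exists refutable ps.
Proof.
  intros Hn Hs; apply (node_ok_Exists (@refutable_sqeq P A) Hn).
  intros c ps' Hi Hsc; exact (inst_refutable Hi (refutable_sqeq Hsc Hs)).
Qed.

Lemma node_ok_equal_or_refutable S r s ps :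
  equal_or_refutable S s -> node_ok r s ps ->
  (sqeq s S -> forall c ps', inst r c ps' -> sqeq c S -> Exists (equal_or_refutable S) ps') ->
  Exists (equal_or_refutable S) ps.
Proof.
  intros [Hs|Hs] Hn Hinst;
    [|exact (Exists_impl _ (fun q => @or_intror _ _) (node_ok_refutable Hn Hs))].
  apply (node_ok_Exists (equal_or_refutable_sqeq (S := S)) Hn); intros c ps' Hi Hsc.
  exact (Hinst Hs c ps' Hi (sqeq_trans (sqeq_sym Hsc) Hs)).
Qed.

Lemma inst_wk_sub c ps S :
  inst (RWk P A) c ps -> sqeq c S ->
  exists G D, ps = [(G, D)] /\ incl G (fst S) /\ incl D (snd S).
Proof.
  intros Hi [HG HD]; inversion Hi; subst.
  exists G, D; split; [reflexivity|].
  split; eapply incl_tran; eauto using seteq_incl.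
Qed.

Lemma inst_cut_member f c ps :
  inst (RCut f) c ps -> In f (fst c) \/ In f (snd c) -> Exists (fun q => sqeq q c) ps.
Proof.
  intros Hi Hf; inversion Hi; subst; cbn in Hf.
  destruct Hf as [Hf|Hf]; [right; left | left];
    split; intros x; cbn; split; intros Hx; intuition congruence.
Qed.

End RuleNodes.

(** * Infinite branches through proof trees *)

Section Trees.
Variables (P A : Type).
Implicit Types (t : tree P A) (a : list nat).

Lemma subtree_app t a b :
  subtree t (a ++ b) = match subtree t a with Some u => subtree u b | None => None end.
Proof.
  revert t; induction a as [|k a IH]; intros [s r ts]; cbn; [reflexivity|].
  destruct (nth_error ts k); [apply IH | reflexivity].
Qed.

Fixpoint height t : nat :=
  match t with Node _ _ ts => S (list_max (map height ts)) end.

Lemma subtree_height t a u : subtree t a = Some u -> length a < height t.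
Proof.
  revert t; induction a as [|k a IH]; intros [s r ts]; cbn; [lia|].
  destruct (nth_error ts k) as [t'|] eqn:Hk; [|discriminate].
  intros Ha; specialize (IH _ Ha).
  pose proof (proj1 (list_max_le (map height ts) _) (le_n _)) as Hmax.
  rewrite Forall_forall in Hmax.
  specialize (Hmax _ (in_map height _ _ (nth_error_In _ _ Hk))); lia.
Qed.

Lemma bud_free_no_infinite_path t (f : nat -> list nat) (ks : nat -> nat) :
  (forall a s r ts, subtree t a = Some (Node s r ts) -> bud_target r = None) ->
  ~ (forall i, edge t (f i) (ks i) (f (S i))).
Proof.
  intros Hnb He.
  assert (Hlen : forall i, i <= length (f i)).
  { induction i as [|i IH]; [lia|].
    destruct (He i) as [s [r [ts [[sc rc tsc] [Ha [_ [Hk ->]]]]]]]; cbn.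
    assert (Hsub : subtree t (f i ++ [ks i]) = Some (Node sc rc tsc)).
    { rewrite subtree_app, Ha; cbn; rewrite Hk; reflexivity. }
    rewrite (Hnb _ _ _ _ Hsub), length_app; cbn; lia. }
  destruct (He (height t)) as [s [r [ts [c [Ha _]]]]].
  specialize (Hlen (height t)); apply subtree_height in Ha; lia.
Qed.

End Trees.

Lemma infinite_labelled_path {X L : Type} (Q : X -> Prop) (E : X -> L -> X -> Prop) x0 :
  Q x0 -> (forall x, Q x -> exists l y, E x l y /\ Q y) ->
  exists (f : nat -> X) (ks : nat -> L), forall i, Q (f i) /\ E (f i) (ks i) (f (S i)).
Proof.
  intros H0 Hstep.
  destruct (Hstep x0 H0) as [l0 _].
  pose (good x (ly : L * X) := Q x -> E x (fst ly) (snd ly) /\ Q (snd ly)).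
  pose (next x := epsilon (inhabits (l0, x0)) (good x)).
  assert (Hnext : forall x, Q x -> E x (fst (next x)) (snd (next x)) /\ Q (snd (next x))).
  { intros x Hx; apply (epsilon_spec _ (good x)); [|exact Hx].
    destruct (Hstep x Hx) as [l [y Hy]]; exists (l, y); intros _; exact Hy. }
  pose (f n := Nat.iter n (fun x => snd (next x)) x0).
  assert (Hf : forall i, Q (f i)).
  { induction i as [|i IH]; [exact H0 | exact (proj2 (Hnext _ IH))]. }
  exists f, (fun i => fst (next (f i))); intros i.
  split; [exact (Hf i) | exact (proj1 (Hnext _ (Hf i)))].
Qed.

Section Invariants.
Variables (P A : Type) (Q : sequent P A -> Prop).
Hypothesis Q_sqeq : forall s s', sqeq s s' -> Q s -> Q s'.
Implicit Types (t : tree P A) (ok : sequent P A -> rlab P A -> Prop).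

Definition inner_node_with t (a : list nat) : Prop :=
  exists s r ts, subtree t a = Some (Node s r ts) /\ bud_target r = None /\ Q s.

Lemma companion_not_bud ok t b s r ts :
  wf_tree ok t -> subtree t b = Some (Node s r ts) -> ts <> [] -> bud_target r = None.
Proof.
  intros Hwf Hb Hne; destruct (bud_target r) eqn:Er; [|reflexivity].
  destruct (Hwf _ _ _ _ Hb) as [_ Hm]; rewrite Er in Hm.
  destruct Hm as [-> _]; contradiction.
Qed.

Lemma root_not_bud ok s r ts : wf_tree ok (Node s r ts) -> bud_target r = None.
Proof.
  intros Hwf; destruct (bud_target r) as [b|] eqn:Er; [|reflexivity].
  destruct (Hwf [] s r ts eq_refl) as [_ Hm]; rewrite Er in Hm.
  destruct Hm as [-> [s' [r' [ts' [Hb [Hne _]]]]]].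
  destruct b as [|[] b]; cbn in Hb; [injection Hb as _ _ <-|..]; congruence.
Qed.

Section Closed.
Variables (ok : sequent P A -> rlab P A -> Prop) (t : tree P A).
Hypothesis t_wf : wf_tree ok t.
Hypothesis Q_closed : forall s r ps, Q s -> ok s r -> node_ok r s ps -> Exists Q ps.

Lemma inner_node_with_step a :
  inner_node_with t a -> exists k b, edge t a k b /\ inner_node_with t b.
Proof.
  intros [s [r [ts [Ha [Hr HQ]]]]].
  destruct (t_wf Ha) as [Hok Hm]; rewrite Hr in Hm.
  pose proof (Q_closed HQ Hok Hm) as Hc.
  rewrite Exists_map, Exists_exists in Hc; destruct Hc as [[sc rc tsc] [Hin HQc]].
  apply In_nth_error in Hin as [k Hk].
  assert (Hsub : subtree t (a ++ [k]) = Some (Node sc rc tsc)).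
  { rewrite subtree_app, Ha; cbn; rewrite Hk; reflexivity. }
  exists k, (succ_addr a k (Node sc rc tsc)); split; [exists s, r, ts, (Node sc rc tsc); auto|].
  cbn; destruct (bud_target rc) as [b|] eqn:Eb; [|exists sc, rc, tsc; auto].
  destruct (t_wf Hsub) as [_ Hm']; rewrite Eb in Hm'.
  destruct Hm' as [_ [s' [r' [ts' [Hb [Hne Hss]]]]]].
  exists s', r', ts'; repeat split; [exact Hb | exact (companion_not_bud t_wf Hb Hne) | ].
  exact (Q_sqeq Hss HQc).
Qed.

Lemma inner_node_with_path :
  inner_node_with t [] ->
  exists f ks, forall i, inner_node_with t (f i) /\ edge t (f i) (ks i) (f (S i)).
Proof.
  intros H0; apply (infinite_labelled_path H0), inner_node_with_step.
Qed.

End Closed.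

Lemma inner_node_with_root ok s r ts S :
  wf_tree ok (Node s r ts) -> sqeq s S -> Q S -> inner_node_with (Node s r ts) [].
Proof.
  intros Hwf Hs HS; exists s, r, ts; split; [reflexivity|].
  exact (conj (root_not_bud Hwf) (Q_sqeq (sqeq_sym Hs) HS)).
Qed.

Lemma not_GProv_of_invariant pol S :
  (forall s r ps, Q s -> ~ is_cs r -> cut_ok pol s r -> node_ok r s ps -> Exists Q ps) ->
  Q S -> ~ GProv pol S.
Proof.
  intros Hcl HS [[s r ts] [Hroot Hwf]].
  assert (Hcl' : forall s r ps, Q s -> ~ is_bud r /\ ~ is_cs r /\ cut_ok pol s r ->
                   node_ok r s ps -> Exists Q ps).
  { intros s' r' ps HQ [_ [Hcs Hcut]]; exact (Hcl s' r' ps HQ Hcs Hcut). }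
  destruct (inner_node_with_path Hwf Hcl' (inner_node_with_root Hwf Hroot HS)) as [f [ks Hf]].
  refine (bud_free_no_infinite_path _ (fun i => proj2 (Hf i))).
  intros a s' r' ts' Ha; destruct (Hwf _ _ _ _ Ha) as [[Hb _] _].
  destruct r'; try reflexivity; exfalso; apply Hb; eexists; reflexivity.
Qed.

Lemma not_CGProv_of_invariant pol S :
  (forall s r ps, Q s -> ~ is_starR r -> cut_ok pol s r -> node_ok r s ps -> Exists Q ps) ->
  (forall s r ps, Q s -> node_ok r s ps -> ~ is_cs r) ->
  Q S -> ~ CGProv pol S.
Proof.
  intros Hcl Hcs HS [[s r ts] [Hroot [Hwf Hgood]]].
  assert (Hcl' : forall s r ps, Q s -> ~ is_starR r /\ cut_ok pol s r ->
                   node_ok r s ps -> Exists Q ps).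
  { intros s' r' ps HQ [HsR Hcut]; exact (Hcl s' r' ps HQ HsR Hcut). }
  destruct (inner_node_with_path Hwf Hcl' (inner_node_with_root Hwf Hroot HS)) as [f [ks Hf]].
  (* a progress point of the branch would be a (C-s) step at a node satisfying Q *)
  destruct (Hgood f ks (fun i => proj2 (Hf i))) as [N [tau [_ Hprogress]]].
  destruct (Hprogress 0) as [i [_ [_ [r' [Hl [p [g [-> _]]]]]]]].
  destruct (proj1 (Hf i)) as [s' [r'' [ts' [Hi [Hr HQ]]]]].
  unfold lab_at in Hl; rewrite Hi in Hl; injection Hl as ->.
  destruct (Hwf _ _ _ _ Hi) as [_ Hm].
  exact (Hcs _ _ _ HQ Hm (ex_intro _ p (ex_intro _ g eq_refl))).
Qed.

End Invariants.

Section Derivations.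
Variables (P A : Type).
Implicit Types (t : tree P A) (ok : sequent P A -> rlab P A -> Prop).

Inductive bud_free_derivation ok : tree P A -> Prop :=
| bud_free_derivation_node s r ts :
    ok s r -> node_ok r s (map (@root_seq P A) ts) -> Forall (bud_free_derivation ok) ts ->
    bud_free_derivation ok (Node s r ts).

Lemma bud_free_derivation_subtree ok t a u :
  bud_free_derivation ok t -> subtree t a = Some u -> bud_free_derivation ok u.
Proof.
  revert t; induction a as [|k a IH]; intros [s r ts] Ht Ha; cbn in Ha.
  - injection Ha as <-; exact Ht.
  - destruct (nth_error ts k) as [c|] eqn:Hk; [|discriminate].
    apply (IH c); [|exact Ha].
    inversion Ht as [? ? ? _ _ Hts]; subst.
    exact (proj1 (Forall_forall _ _) Hts c (nth_error_In _ _ Hk)).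
Qed.

Lemma bud_free_derivation_wf ok t : bud_free_derivation ok t -> wf_tree ok t.
Proof.
  intros Ht a s r ts Ha; pose proof (bud_free_derivation_subtree Ht Ha) as Hd.
  inversion Hd as [? ? ? Hok Hn _]; subst.
  rewrite (node_ok_not_bud Hn); exact (conj Hok Hn).
Qed.

Lemma bud_free_derivation_good_paths ok t : bud_free_derivation ok t -> good_paths t.
Proof.
  intros Ht f ks Hf; exfalso; refine (bud_free_no_infinite_path _ Hf).
  intros a s r ts Ha; pose proof (bud_free_derivation_subtree Ht Ha) as Hd.
  inversion Hd as [? ? ? _ Hn _]; subst.
  exact (node_ok_not_bud Hn).
Qed.

Lemma bud_free_derivation_GProv pol t :
  bud_free_derivation (fun s r => ~ is_bud r /\ ~ is_cs r /\ cut_ok pol s r) t ->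
  GProv pol (root_seq t).
Proof. intros Ht; exists t; split; [apply sqeq_refl | exact (bud_free_derivation_wf Ht)]. Qed.

Lemma bud_free_derivation_CGProv pol t :
  bud_free_derivation (fun s r => ~ is_starR r /\ cut_ok pol s r) t ->
  CGProv pol (root_seq t).
Proof.
  intros Ht; exists t; split; [apply sqeq_refl|].
  exact (conj (bud_free_derivation_wf Ht) (bud_free_derivation_good_paths Ht)).
Qed.

Lemma GProv_mono (pol pol' : cutpol P A) S :
  (forall s f, pol s f -> pol' s f) -> GProv pol S -> GProv pol' S.
Proof.
  intros Hpol [t [Hroot Hwf]]; exists t; split; [exact Hroot|].
  intros a s r ts Ha; destruct (Hwf _ _ _ _ Ha) as [[Hb [Hcs Hcut]] Hm].
  split; [|exact Hm]; repeat split; [exact Hb | exact Hcs |].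
  intros f Hf; exact (Hpol _ _ (Hcut f Hf)).
Qed.

End Derivations.

Fixpoint star_free {P A : Type} (f : form P A) : Prop :=
  match f with
  | Bot | Var _ => True
  | Imp f g => star_free f /\ star_free g
  | Box pi f | BoxB pi f => star_free_prog pi /\ star_free f
  end
with star_free_prog {P A : Type} (pi : prog P A) : Prop :=
  match pi with
  | Atom _ => True
  | Seq p0 p1 | Cho p0 p1 => star_free_prog p0 /\ star_free_prog p1
  | Star _ => False
  | Test f => star_free f
  end.

Definition star_free_seq {P A : Type} (s : sequent P A) : Prop :=
  Forall star_free (fst s) /\ Forall star_free (snd s).

Section StarFree.
Variables (P A : Type).
Implicit Types (s c : sequent P A) (r : rlab P A).

Lemma star_free_seq_sqeq s s' : sqeq s s' -> star_free_seq s -> star_free_seq s'.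
Proof.
  intros [HG HD] [HsG HsD]; split;
    [exact (incl_Forall (fun x => proj2 (HG x)) HsG)
    |exact (incl_Forall (fun x => proj2 (HD x)) HsD)].
Qed.

Lemma inst_star_free r c ps :
  inst r c ps -> (forall f, r <> RCut f) -> star_free_seq c -> Forall star_free_seq ps.
Proof.
  intros Hi Hnc [HG HD]; apply Forall_forall; intros q Hq.
  destruct Hi; cbn in HG, HD, Hq.
  all: rewrite ?Forall_cons_iff, ?Forall_map in HG; rewrite ?Forall_cons_iff, ?Forall_map in HD.
  all: cbn in HG, HD.
  all: repeat destruct Hq as [<-|Hq]; try contradiction.
  all: unfold star_free_seq; cbn; rewrite ?Forall_cons_iff, ?Forall_map; cbn; try tauto.
  all: try exact (conj (incl_Forall H HG) (incl_Forall H0 HD)).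
  all: try (exfalso; exact (Hnc f eq_refl)).
  all: destruct HD as [[Hpi Hf] HD]; split; [refine (Forall_impl _ _ HG); tauto|].
  all: split; [exact Hf | refine (Forall_impl _ _ HD); tauto].
Qed.

Lemma node_ok_star_free r s ps :
  star_free_seq s -> (forall f, r <> RCut f) -> node_ok r s ps -> Forall star_free_seq ps.
Proof.
  intros Hs Hnc Hn; apply (node_ok_Forall star_free_seq_sqeq Hn); intros c ps' Hi Hsc.
  exact (inst_star_free Hi Hnc (star_free_seq_sqeq Hsc Hs)).
Qed.

Lemma node_ok_star_free_not_cs r s ps : star_free_seq s -> node_ok r s ps -> ~ is_cs r.
Proof.
  intros Hs [c [ps' [Hi [Hsc _]]]] [p [f ->]]; inversion Hi; subst.
  destruct (star_free_seq_sqeq Hsc Hs) as [_ [[[] _] _]%Forall_cons_iff].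
Qed.

End StarFree.

Lemma incl_drop {X : Type} (m1 : list X) x m2 l :
  incl l (m1 ++ x :: m2) -> ~ In x l -> incl l (m1 ++ m2).
Proof.
  intros Hl Hx y Hy; specialize (Hl y Hy).
  apply in_app_or in Hl as [Hm1|[<-|Hm2]]; apply in_or_app; tauto.
Qed.

(** * The sequents of the theorem *)

Section Theorem9Sequents.
Variables (P A : Type) (p : P) (a : A).

Let star_p : form P A := Box (Star (Atom a)) (Var p).
Let step_star_p : form P A := Box (Atom a) star_p.
Let S1 : sequent P A := ([Var p; step_star_p], [star_p]).
Let not_p : form P A := Neg (Var p).
Let box_not_p : form P A := BoxB (Atom a) not_p.
Let back_p : form P A := DiaB (Atom a) (Var p).
Let box_back_p : form P A := Box (Atom a) back_p.
Let S2 : sequent P A := ([Var p], [box_back_p]).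

Lemma inFL_S1 f c :
  In c [Var p; step_star_p; star_p] -> inFL f c -> In f [Var p; step_star_p; star_p].
Proof.
  intros Hc Hf; cbn in Hc; repeat destruct Hc as [<-|Hc]; try contradiction.
  all: repeat match goal with
         | H : inFL _ _ |- _ => inversion H; subst; clear H
         | H : inFLb _ _ |- _ => inversion H; subst; clear H
         end.
  all: cbn; tauto.
Qed.

Lemma flCut_S1 s f : sqeq s S1 -> flCut s f -> In f (fst S1) \/ In f (snd S1).
Proof.
  intros [HG HD] [c [Hc Hf]].
  assert (HcS1 : In c [Var p; step_star_p; star_p]).
  { apply in_app_or in Hc as [Hc|Hc]; [apply HG in Hc | apply HD in Hc]; cbn in *; tauto. }
  destruct (inFL_S1 HcS1 Hf) as [<-|[<-|[<-|[]]]]; cbn; tauto.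
Qed.

Lemma inst_conclusion_S1 r c ps :
  inst r c ps -> sqeq c S1 -> r = RWk P A \/ (exists f, r = RCut f) \/ is_cs r.
Proof.
  intros Hi [HG HD]; destruct Hi; cbn in HG, HD.
  all: try (left; reflexivity); try (right; left; eexists; reflexivity);
    try (right; right; do 2 eexists; reflexivity); exfalso.
  all: try (destruct (proj1 (HG _) (or_introl eq_refl)) as [E|[E|[]]]; discriminate).
  all: try (destruct (proj1 (HD _) (or_introl eq_refl)) as [E|[]]; discriminate).
  - apply HG in H; apply HD in H0; destruct H0 as [<-|[]].
    destruct H as [E|[E|[]]]; discriminate.
  - apply HG in H; destruct H as [E|[E|[]]]; discriminate.
  - destruct (proj1 (in_map_iff _ _ _) (proj2 (HG (Var p)) (or_introl eq_refl))) as [x [E _]].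
    discriminate.
  - destruct (proj1 (HD _) (or_introl eq_refl)) as [E|[]]; injection E as E1 E2; subst.
    destruct (proj2 (HG step_star_p) (or_intror (or_introl eq_refl))) as [E|E];
      [discriminate | apply in_map_iff in E as [x [E _]]; discriminate].
Qed.

Lemma refutable_S1_without_p : refutable ([step_star_p], [star_p]).
Proof.
  apply (refutable_at (R := fun _ _ _ => False) (V := fun _ _ => False) (w := tt));
    repeat constructor; cbn.
  - intros v [].
  - intros H; exact (H tt (rt_refl _ _ _)).
Qed.

Lemma refutable_S1_without_step : refutable ([Var p], [star_p]).
Proof.
  apply (refutable_at (R := fun _ x y => x = true /\ y = false) (V := fun _ x => x = true)
           (w := true)); repeat constructor; cbn.
  intros H; discriminate (H false (rt_step _ _ _ _ (conj eq_refl eq_refl))).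
Qed.

Lemma refutable_S1_without_goal : refutable ([Var p; step_star_p], []).
Proof.
  apply (refutable_at (R := fun _ _ _ => False) (V := fun _ _ => True) (w := tt));
    repeat constructor; cbn; intros v [].
Qed.

Lemma sub_S1 G D :
  incl G [Var p; step_star_p] -> incl D [star_p] -> equal_or_refutable S1 (G, D).
Proof.
  intros HG HD.
  destruct (classic (In (Var p) G)) as [Hp|Hp]; [|right].
  2: exact (refutable_weaken (incl_drop (m1 := []) HG Hp) HD refutable_S1_without_p).
  destruct (classic (In step_star_p G)) as [Hs|Hs]; [|right].
  2: exact (refutable_weaken (incl_drop (m1 := [Var p]) HG Hs) HD refutable_S1_without_step).
  destruct (classic (In star_p D)) as [Hg|Hg]; [left|right].
  - split; intros x; split;
      [apply HG | intros [<-|[<-|[]]]; assumption | apply HD | intros [<-|[]]; assumption].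
  - exact (refutable_weaken HG (incl_drop (m1 := []) HD Hg) refutable_S1_without_goal).
Qed.

Lemma S1_invariant s r ps :
  equal_or_refutable S1 s -> ~ is_cs r -> cut_ok flCut s r -> node_ok r s ps ->
  Exists (equal_or_refutable S1) ps.
Proof.
  intros Hs Hcs Hcut Hn; apply (node_ok_equal_or_refutable Hs Hn); intros HsS1 c ps' Hi HcS1.
  destruct (inst_conclusion_S1 Hi HcS1) as [->|[[f ->]|Hcs']]; [| |contradiction].
  - destruct (inst_wk_sub Hi HcS1) as [G [D [-> [HG HD]]]].
    exact (Exists_cons_hd _ _ _ (sub_S1 HG HD)).
  - refine (Exists_impl _ (fun q Hq => or_introl (sqeq_trans Hq HcS1)) (inst_cut_member Hi _)).
    destruct HcS1 as [HG HD]; rewrite (HG f), (HD f).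
    exact (flCut_S1 HsS1 (Hcut f eq_refl)).
Qed.

Lemma not_GProv_flCut_S1 : ~ GProv flCut S1.
Proof.
  apply (not_GProv_of_invariant (equal_or_refutable_sqeq (S := S1))); [|left; apply sqeq_refl].
  intros s r ps Hs Hcs Hcut; exact (S1_invariant Hs Hcs Hcut).
Qed.

Lemma not_GProv_noCut_S1 : ~ GProv noCut S1.
Proof.
  intros H; apply not_GProv_flCut_S1; revert H; apply GProv_mono; intros _ _ [].
Qed.

Definition cs_proof_S1 : tree P A :=
  Node S1 (RCs (Atom a) (Var p))
    [Node ([Var p; step_star_p], [Var p]) (RAx P A) [];
     Node ([Var p; step_star_p], [step_star_p]) (RAx P A) []].

Lemma CGProv_noCut_S1 : CGProv noCut S1.
Proof.
  apply (bud_free_derivation_CGProv (t := cs_proof_S1)).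
  repeat constructor; try (intros [? [? E]] || intros ? E); try discriminate.
  all: apply node_ok_of_inst.
  - exact (i_cs [Var p; step_star_p] [] (Atom a) (Var p)).
  - apply i_ax with (Var p); cbn; auto.
  - apply i_ax with step_star_p; cbn; auto.
Qed.

Definition cut_proof_S2 : tree P A :=
  Node S2 (RCut not_p)
    [Node ([Var p], [not_p; box_back_p]) (RWk P A)
       [Node ([], [box_back_p; not_p]) (RBox (Atom a) back_p)
          [Node ([], [back_p; box_not_p]) (RImpR box_not_p Bot)
             [Node ([box_not_p], [Bot; box_not_p]) (RAx P A) []]]];
     Node ([not_p; Var p], [box_back_p]) (RImpL (Var p) Bot)
       [Node ([Var p], [Var p; box_back_p]) (RAx P A) [];
        Node ([Bot; Var p], [box_back_p]) (RBot P A) []]].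

Lemma cut_proof_S2_derivation (ok : sequent P A -> rlab P A -> Prop) :
  (forall s r, ~ is_bud r -> ~ is_cs r -> ~ is_starR r -> ok s r) ->
  bud_free_derivation ok cut_proof_S2.
Proof.
  intros Hok; repeat constructor.
  all: try (apply Hok; [intros [? E] | intros [? [? E]] | intros [? [? E]]]; discriminate).
  all: apply node_ok_of_inst.
  - exact (i_cut [Var p] [box_back_p] not_p).
  - apply i_wk; intros x; cbn; tauto.
  - exact (i_box [] [not_p] (Atom a) back_p).
  - exact (i_impR [] [box_not_p] box_not_p Bot).
  - apply i_ax with box_not_p; cbn; auto.
  - exact (i_impL [Var p] [box_back_p] (Var p) Bot).
  - apply i_ax with (Var p); cbn; auto.
  - apply i_bot; cbn; auto.
Qed.

Lemma GProv_anyCut_S2 : GProv anyCut S2.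
Proof.
  apply (bud_free_derivation_GProv (t := cut_proof_S2)), cut_proof_S2_derivation.
  intros s r Hb Hcs _; exact (conj Hb (conj Hcs (fun _ _ => I))).
Qed.

Lemma CGProv_anyCut_S2 : CGProv anyCut S2.
Proof.
  apply (bud_free_derivation_CGProv (t := cut_proof_S2)), cut_proof_S2_derivation.
  intros s r _ _ HsR; exact (conj HsR (fun _ _ => I)).
Qed.

Lemma inst_conclusion_S2 r c ps :
  inst r c ps -> sqeq c S2 -> r = RWk P A \/ exists f, r = RCut f.
Proof.
  intros Hi [HG HD]; destruct Hi; cbn in HG, HD.
  all: try (left; reflexivity); try (right; eexists; reflexivity); exfalso.
  all: try (destruct (proj1 (HG _) (or_introl eq_refl)) as [E|[]]; discriminate).
  all: try (destruct (proj1 (HD _) (or_introl eq_refl)) as [E|[]]; discriminate).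
  - apply HG in H; apply HD in H0; destruct H0 as [<-|[]].
    destruct H as [E|[]]; discriminate.
  - apply HG in H; destruct H as [E|[]]; discriminate.
  - destruct (proj1 (in_map_iff _ _ _) (proj2 (HG (Var p)) (or_introl eq_refl))) as [x [E _]].
    discriminate.
Qed.

Lemma refutable_S2_without_p : refutable ([], [box_back_p]).
Proof.
  apply (refutable_at (R := fun _ x y => x = true /\ y = false) (V := fun _ _ => False)
           (w := true)); repeat constructor; cbn.
  intros H; apply (H false (conj eq_refl eq_refl)); intros u _ [].
Qed.

Lemma refutable_S2_without_goal : @refutable P A ([Var p], []).
Proof.
  refine (refutable_weaken _ (incl_refl []) refutable_S1_without_goal).
  intros x [<-|[]]; left; reflexivity.
Qed.

Lemma sub_S2 G D :
  incl G [Var p] -> incl D [box_back_p] -> equal_or_refutable S2 (G, D).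
Proof.
  intros HG HD.
  destruct (classic (In (Var p) G)) as [Hp|Hp]; [|right].
  2: exact (refutable_weaken (incl_drop (m1 := []) HG Hp) HD refutable_S2_without_p).
  destruct (classic (In box_back_p D)) as [Hg|Hg]; [left|right].
  - split; intros x; split;
      [apply HG | intros [<-|[]]; assumption | apply HD | intros [<-|[]]; assumption].
  - exact (refutable_weaken HG (incl_drop (m1 := []) HD Hg) refutable_S2_without_goal).
Qed.

Lemma S2_invariant s r ps :
  star_free_seq s /\ equal_or_refutable S2 s -> cut_ok noCut s r -> node_ok r s ps ->
  Exists (fun q => star_free_seq q /\ equal_or_refutable S2 q) ps.
Proof.
  intros [Hsf Hs] Hcut Hn.
  assert (Hnc : forall f, r <> RCut f) by (intros f ->; exact (Hcut f eq_refl)).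
  assert (HS2 : Exists (equal_or_refutable S2) ps).
  { apply (node_ok_equal_or_refutable Hs Hn); intros _ c ps' Hi HcS2.
    destruct (inst_conclusion_S2 Hi HcS2) as [->|[f ->]]; [|destruct (Hnc f eq_refl)].
    destruct (inst_wk_sub Hi HcS2) as [G [D [-> [HG HD]]]].
    exact (Exists_cons_hd _ _ _ (sub_S2 HG HD)). }
  pose proof (proj1 (Forall_forall _ _) (node_ok_star_free Hsf Hnc Hn)) as Hps.
  apply Exists_exists in HS2 as [q [Hq HqS2]]; apply Exists_exists.
  exact (ex_intro _ q (conj Hq (conj (Hps q Hq) HqS2))).
Qed.

Lemma S2_invariant_sqeq s s' :
  sqeq s s' -> star_free_seq s /\ equal_or_refutable S2 s ->
  star_free_seq s' /\ equal_or_refutable S2 s'.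
Proof.
  intros Hs [Hsf HsS2].
  exact (conj (star_free_seq_sqeq Hs Hsf) (equal_or_refutable_sqeq Hs HsS2)).
Qed.

Lemma S2_invariant_S2 : star_free_seq S2 /\ equal_or_refutable S2 S2.
Proof. split; [repeat constructor | left; apply sqeq_refl]. Qed.

Lemma not_GProv_noCut_S2 : ~ GProv noCut S2.
Proof.
  apply (not_GProv_of_invariant S2_invariant_sqeq); [|exact S2_invariant_S2].
  intros s r ps Hs _ Hcut; exact (S2_invariant Hs Hcut).
Qed.

Lemma not_CGProv_noCut_S2 : ~ CGProv noCut S2.
Proof.
  apply (not_CGProv_of_invariant S2_invariant_sqeq); [| |exact S2_invariant_S2].
  - intros s r ps Hs _ Hcut; exact (S2_invariant Hs Hcut).
  - intros s r ps [Hsf _]; exact (node_ok_star_free_not_cs Hsf).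
Qed.

End Theorem9Sequents.

Theorem mainTheorem9 (P A : Type) (p : P) (a : A) :
  let S1 : sequent P A :=
    ([Var p; Box (Atom a) (Box (Star (Atom a)) (Var p))],
     [Box (Star (Atom a)) (Var p)]) in
  let S2 : sequent P A :=
    ([Var p], [Box (Atom a) (DiaB (Atom a) (Var p))]) in
  (* (1) *) (~ GProv noCut S1 /\ ~ GProv flCut S1) /\
  (* (2) *) CGProv noCut S1 /\
  (* (3) *) (GProv anyCut S2 /\ CGProv anyCut S2) /\
  (* (4) *) (~ GProv noCut S2 /\ ~ CGProv noCut S2).
Proof.
  intros S1 S2.
  split; [split|split; [|split; split]].
  - apply not_GProv_noCut_S1.
  - apply not_GProv_flCut_S1.
  - apply CGProv_noCut_S1.
  - apply GProv_anyCut_S2.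
  - apply CGProv_anyCut_S2.
  - apply not_GProv_noCut_S2.
  - apply not_CGProv_noCut_S2.
Qed.
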